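(* There is an absolute constant $K$ with $K \le 2.0005$ such that for every real matrix $A \in \mathbb{R}^{m \times n}$ and all integers $a, b \ge 2$, \[ \operatorname{herdisc}(A,b) \le K\, a\, \operatorname{herdisc}(A,a). \]
   Context: For $A=(a_{ij}) \in \mathbb{R}^{m\times n}$, an integer $c \ge 2$ and a $c$-coloring $p:[n]\to[c]$ (where $[c]=\{1,\dots,c\}$), define $\operatorname{disc}(A,p,c) := \max_{d\in[c],\, i\in[m]} \left| \sum_{j \in p^{-1}(d)} a_{ij} - \frac{1}{c}\sum_{j\in[n]} a_{ij}\right|$, $\operatorname{disc}(A,c) := \min_{p:[n]\to[c]} \operatorname{disc}(A,p,c)$, and $\operatorname{herdisc}(A,c) := \max_{A_0} \operatorname{disc}(A_0,c)$, where the maximum ranges over all submatrices $A_0$ of $A$ (obtained by deleting some rows and columns of $A$). For a hypergraph, these quantities applied to its incidence matrix give its $c$-color (hereditary) discrepancy. *)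

(* Defs.v *)
From HB Require Import structures.
From mathcomp Require Import all_boot all_order all_algebra.
From mathcomp Require Import reals.

Set Implicit Arguments.
Unset Strict Implicit.
Unset Printing Implicit Defensive.

Import Order.TTheory GRing.Theory Num.Theory.
Local Open Scope ring_scope.

(* All maxima below are taken over nonnegative quantities, so the default
   value 0 only matters for an empty range (a matrix without rows), where it
   fixes the maximum to be 0. *)
Definition disc_col (R : realFieldType) (m n c : nat) (A : 'M[R]_(m, n))
    (p : {ffun 'I_n -> 'I_c}) : R :=
  \big[Num.max/0]_(d < c) \big[Num.max/0]_(i < m)
    `| \sum_(j < n | p j == d) A i j - c%:R^-1 * \sum_(j < n) A i j |.

(* The minimum of a nonempty sequence; the empty sequence gets 0. *)
Definition seq_min (R : realFieldType) (s : seq R) : R :=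
  \big[Num.min/head 0 s]_(x <- s) x.

Definition disc (R : realFieldType) (m n : nat) (A : 'M[R]_(m, n)) (c : nat)
    : R :=
  seq_min [seq disc_col A p | p : {ffun 'I_n -> 'I_c}].

(* I and J are the sets of rows and columns that are kept; [enum_val] lists
   them in increasing order. *)
Definition herdisc (R : realFieldType) (m n : nat) (A : 'M[R]_(m, n))
    (c : nat) : R :=
  \big[Num.max/0]_(I : {set 'I_m}) \big[Num.max/0]_(J : {set 'I_n})
    disc (mxsub (@enum_val _ (mem I)) (@enum_val _ (mem J)) A) c.

Lemma disc_le_col (R : realFieldType) (m n c : nat) (A : 'M[R]_(m, n))
    (p : {ffun 'I_n -> 'I_c}) : disc A c <= disc_col A p.
Proof.
rewrite /disc /seq_min; apply: ge_bigmin_seq => //.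
by apply/imageP; exists p.
Qed.

Lemma disc_attained (R : realFieldType) (m n c : nat) (A : 'M[R]_(m, n)) :
  (0 < c)%N -> exists p : {ffun 'I_n -> 'I_c}, disc A c = disc_col A p.
Proof.
case: c => // c _; rewrite /disc /seq_min.
set s := image _ _.
have s_gt0 : (0 < size s)%N.
  by rewrite size_image; apply/card_gt0P; exists [ffun=> ord0].
have sP x : x \in s -> exists p : {ffun 'I_n -> 'I_c.+1}, x = disc_col A p.
  by case/imageP => p _ ->; exists p.
rewrite big_seq; elim/big_ind: _ => [|x y hx hy|x /sP //].
  by apply: sP; rewrite -nth0 mem_nth.
by case: leP.
Qed.

(* Main.v *)
(* Put u = a * herdisc A a. An a-coloring of discrepancy h lets one pick, in
   every column set, a fraction d/a of it in all rows up to min(d, a - d) * h.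
   Using this digit by digit on the base-a expansion of p in [0, 1], where the
   error made at each digit is divided by a at the next one, one picks a
   fraction p up to u * phi(p); here phi = 1 is always possible, while
   phi(1/2) = 1/2 for even a and phi(p) = 1/2 + min(p, 1 - p) for odd a.
   Splitting k + l colors into k and l colors then costs u * phi(k/(k+l)),
   shared by k, resp. l, colors. For even a, halving even numbers of colors and
   removing one color from odd ones gives an error of at most (2 - 2/b) * u.
   For odd a, splitting off the largest power of 2 below b gives
   (2 - 1/b - 1/2^j) * u whenever b <= 2^j. Hence K = 2 suffices. *)
Require Import Defs.
From HB Require Import structures.
From mathcomp Require Import all_boot all_order all_algebra.
From mathcomp Require Import reals.
From mathcomp Require Import ring lra zify.

Set Implicit Arguments.
Unset Strict Implicit.
Unset Printing Implicit Defensive.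

Import Order.TTheory GRing.Theory Num.Theory.
Local Open Scope ring_scope.

(** * Splittings and balanced colorings of column sets *)

Section Splitting.
Variables (R : archiRealFieldType) (I T : finType) (w : I -> T -> R).
Implicit Types (i : I) (J X : {set T}) (p q e h : R).

Definition mass i J : R := \sum_(j in J) w i j.

(** Asking this of every [J] makes the notion hereditary, so that a splitting can be repeated inside
    its own parts. One set [X] serves all rows at once. *)
Definition splittable p e := forall J, exists2 X : {set T},
  X \subset J & forall i, `|mass i X - p * mass i J| <= e.

(** Colors are natural numbers below [b], so that two palettes are put side by side by shifting one
    of them. *)
Definition colorable (b : nat) e := forall J, exists2 c : T -> nat,
  (forall j, (c j < b)%N) &
  forall i k, (k < b)%N ->
    `|mass i [set j in J | c j == k] - b%:R^-1 * mass i J| <= e.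

Lemma massD i J X : X \subset J -> mass i (J :\: X) = mass i J - mass i X.
Proof.
move=> /setIidPr XJ; apply/eqP; rewrite eq_sym subr_eq addrC.
by rewrite /mass (big_setID X) /= XJ.
Qed.

Lemma massU i J X : [disjoint J & X] -> mass i (J :|: X) = mass i J + mass i X.
Proof. by move=> JX; rewrite /mass -bigU //; apply: eq_bigl => j; rewrite inE. Qed.

Lemma splittable_le p e e' : e <= e' -> splittable p e -> splittable p e'.
Proof.
by move=> ee' Hp J; have [X XJ HX] := Hp J; exists X => // i; apply: le_trans ee'.
Qed.

Lemma colorable_le b e e' : e <= e' -> colorable b e -> colorable b e'.
Proof.
move=> ee' Hb J; have [c cb Hc] := Hb J.
by exists c => // i k kb; apply: le_trans (Hc i k kb) ee'.
Qed.

Lemma splittable1 : splittable 1 0.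
Proof. by move=> J; exists J => // i; rewrite mul1r subrr normr0. Qed.

Lemma splittable_compl p e : splittable p e -> splittable (1 - p) e.
Proof.
move=> Hp J; have [X XJ HX] := Hp J; exists (J :\: X); first exact: subsetDl.
move=> i; rewrite massD // -normrN; apply: le_trans (HX i).
by rewrite [X in `|X|](_ : _ = mass i X - p * mass i J) //; ring.
Qed.

(* The base-[a] step, with [x = d / a] and [y = d.+1 / a]. *)
Lemma splittable_mix x y q ex ey e :
  splittable x ex -> splittable y ey -> splittable q e ->
  splittable (x + q * (y - x)) (ex + ey + `|y - x| * e).
Proof.
move=> Hx Hy Hq J; have [Q QJ HQ] := Hq J.
have [X XD HX] := Hx (J :\: Q); have [Y YQ HY] := Hy Q.
exists (X :|: Y).
  by rewrite subUset (subset_trans XD (subsetDl _ _)) (subset_trans YQ QJ).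
move=> i; rewrite massU; last first.
  rewrite (disjointWl XD) //; apply: disjointWr YQ _.
  rewrite -setI_eq0; apply/eqP/setP => j; rewrite !inE.
  by case: (j \in Q); rewrite ?andbF.
move: (HX i) (HY i) (HQ i); rewrite massD // => HXi HYi HQi.
have -> : mass i X + mass i Y - (x + q * (y - x)) * mass i J =
  (mass i X - x * (mass i J - mass i Q)) + (mass i Y - y * mass i Q)
  + (y - x) * (mass i Q - q * mass i J) by ring.
apply: le_trans (ler_normD _ _) _; apply: lerD.
  by apply: le_trans (ler_normD _ _) _; apply: lerD.
by rewrite normrM ler_wpM2l.
Qed.

Lemma colorable_splittable a h d : (d <= a)%N -> colorable a h ->
  splittable (d%:R / a%:R) (d%:R * h).
Proof.
move=> da Ha J; have [c _ Hc] := Ha J.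
exists [set j in J | (c j < d)%N]; first by apply/subsetP => j; rewrite inE => /andP[].
move=> i; elim: d da => [|d IHd] da.
  rewrite !mul0r subr0 (_ : [set j in J | _] = set0) ?/mass ?big_set0 ?normr0 //.
  by apply/setP => j; rewrite !inE ltn0 andbF.
have -> : [set j in J | (c j < d.+1)%N] =
    [set j in J | (c j < d)%N] :|: [set j in J | c j == d].
  by apply/setP => j; rewrite !inE -andb_orr ltnS leq_eqVlt orbC.
rewrite massU; last first.
  rewrite -setI_eq0; apply/eqP/setP => j; rewrite !inE.
  by case: ltngtP; rewrite ?andbF.
set S := mass i J; set u := mass i _; set v := mass i _.
have -> : u + v - d.+1%:R / a%:R * S = (u - d%:R / a%:R * S) + (v - a%:R^-1 * S).
  by rewrite -natr1; ring.
apply: le_trans (ler_normD _ _) _; rewrite -natr1 mulrDl mul1r.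
by apply: lerD; [exact: IHd (ltnW da)|exact: Hc].
Qed.

(** Either [d] color classes are taken or the other [a - d] are left out, whichever involves fewer
    classes. *)
Lemma colorable_splittable_min a h d : (d <= a)%N -> (0 < a)%N -> colorable a h ->
  splittable (d%:R / a%:R) ((minn d (a - d))%:R * h).
Proof.
move=> da a0 Ha; rewrite /minn; case: ltnP => _; first exact: colorable_splittable.
have -> : d%:R / a%:R = 1 - (a - d)%:R / a%:R :> R.
  have : (a%:R : R) != 0 by rewrite pnatr_eq0 -lt0n.
  by rewrite natrB // => ?; field.
by apply/splittable_compl/colorable_splittable; rewrite ?leq_subr.
Qed.

(** * Arbitrary fractions by base-[a] expansion *)

Lemma splittable_limit p e :
  (forall delta, 0 < delta -> splittable p (e + delta)) -> splittable p e.
Proof.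
move=> Hp J.
pose err X := \big[Num.max/0]_i `|mass i X - p * mass i J|.
(* [J] has finitely many subsets, so one of least error exists; its error is at most [e + delta] for
   every [delta]. *)
have [X XJ minX] := arg_minP err (sub0set J : (fun X => X \subset J) set0).
exists X => // i; apply/ler_addgt0Pr => delta delta0.
have [Y YJ HY] := Hp _ delta0 J.
apply: le_trans (_ : err X <= _); first exact: le_bigmax.
apply: le_trans (minX _ YJ) _.
by apply: bigmax_le => //; apply: le_trans (HY i).
Qed.

(** Error, in units of [h], of the two fractions [d / a] and [d.+1 / a] that are mixed at digit
    [d]. *)
Definition digit_cost a d := (minn d (a - d) + minn d.+1 (a - d.+1))%N.

(** The last hypothesis lets [psi] pay for the leading digit and for the error of the remaining
    ones, which shrinks by the factor [a]. After [L] digits the unread rest costs at most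
    [C / a ^ L], which vanishes in the limit. *)
Lemma splittable_expansion a h (psi : R -> R) :
  (1 < a)%N -> 0 <= h -> colorable a h ->
  (forall q, 0 <= q <= 1 -> 0 <= psi q) ->
  (forall d q, (d < a)%N -> 0 <= q <= 1 ->
     (digit_cost a d)%:R + psi q / a%:R <= psi ((d%:R + q) / a%:R)) ->
  forall p, 0 <= p <= 1 -> splittable p (psi p * h).
Proof.
move=> a1 h0 Ha psi0 psiD.
have a0 : (0 : R) < a%:R by rewrite ltr0n ltnW.
pose C := \sum_i \sum_j `|w i j|.
have C0 : 0 <= C by apply: sumr_ge0 => i _; apply: sumr_ge0.
have leC i J : `|mass i J| <= C.
  apply: le_trans (ler_norm_sum _ _ _) _.
  apply: (@le_trans _ _ (\sum_j `|w i j|)).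
    by rewrite [leRHS](bigID (mem J)) /= lerDl sumr_ge0.
  by rewrite /C (bigD1 i) //= lerDl sumr_ge0 // => ? _; apply: sumr_ge0.
have approx L : forall p, 0 <= p <= 1 -> splittable p (psi p * h + C / a%:R ^+ L).
  elim: L => [|L IHL] p p01.
    (* With no digit read, the empty set errs by [p] times the mass, at most [C]. *)
    move=> J; exists set0 => [|i]; first exact: sub0set.
    rewrite /mass big_set0 sub0r normrN normrM expr0 divr1.
    case/andP: (p01) => p0 p1; rewrite ger0_norm //.
    apply: ler_wpDl; first by rewrite mulr_ge0 // psi0.
    by apply: le_trans (leC i J); rewrite ler_piMl.
  (* [p = 1] is set apart: its leading digit would be [a] itself. *)
  case/andP: (p01) => p0; rewrite le_eqVlt => /predU1P[->|p1].
    apply: splittable_le splittable1; rewrite addr_ge0 ?mulr_ge0 //.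
      by rewrite psi0 // lexx ler01.
    by rewrite invr_ge0 exprn_ge0 // ltW.
  have ap0 : 0 <= a%:R * p by rewrite mulr_ge0 // ltW.
  have /andP[dap apd] := truncn_itv ap0.
  set d := Num.truncn _ in dap apd; pose q := a%:R * p - d%:R.
  have da : (d < a)%N.
    by rewrite -(ltr_nat R); apply: le_lt_trans dap _; rewrite gtr_pMr.
  have q01 : 0 <= q <= 1.
    by rewrite subr_ge0 dap lerBlDr addrC natr1 ltW.
  have pE : p = (d%:R + q) / a%:R by rewrite /q; field; rewrite gt_eqF.
  have := splittable_mix (colorable_splittable_min (ltnW da) (ltnW a1) Ha)
    (colorable_splittable_min da (ltnW a1) Ha) (IHL q q01).
  have -> : d.+1%:R / a%:R - d%:R / a%:R = a%:R^-1 :> R.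
    by rewrite -natr1; ring.
  rewrite -mulrDl -pE; apply: splittable_le.
  rewrite ger0_norm ?invr_ge0 ?(ltW a0) // -mulrDl -natrD.
  have := ler_wpM2r h0 (psiD d q da q01); rewrite -pE /digit_cost => Hpsi.
  have -> : a%:R^-1 * (psi q * h + C / a%:R ^+ L) =
      psi q / a%:R * h + C / a%:R ^+ L.+1.
    by rewrite exprS invfM; ring.
  by rewrite addrA -mulrDl lerD2r.
move=> p p01; apply: splittable_limit => delta delta0.
(* This choice gives [C / delta < 2 ^ L], and [2 <= a]. *)
pose L := Num.bound (C / delta).
apply: splittable_le (approx L p p01); rewrite lerD2l.
rewrite ler_pdivrMr ?exprn_gt0 // mulrC -ler_pdivrMr //.
apply: le_trans (_ : 2 ^+ L <= _); first exact/ltW/upper_nthrootP.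
by rewrite lerXn2r ?nnegrE ?ler0n ?ler_nat.
Qed.

(** * From splittings to colorings *)

Lemma colorable1 : colorable 1 0.
Proof.
move=> J; exists (fun=> 0%N) => // i [|//] _.
rewrite invr1 mul1r (_ : [set j in J | _] = J) ?subrr ?normr0 //.
by apply/setP => j; rewrite inE eqxx andbT.
Qed.

(** The error [D] of the split is shared evenly: each of the [k] colors inherits [D / k] of it, each
    of the [l] colors [D / l]. *)
Lemma colorable_add k l D e1 e2 e :
  (0 < k)%N -> (0 < l)%N -> splittable (k%:R / (k + l)%:R) D ->
  colorable k e1 -> colorable l e2 ->
  e1 + D / k%:R <= e -> e2 + D / l%:R <= e -> colorable (k + l) e.
Proof.
move=> k0 l0 HD Hk Hl He1 He2 J; have [X XJ HX] := HD J.
have [c1 c1k Hc1] := Hk X; have [c2 c2l Hc2] := Hl (J :\: X).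
have kR : (0 : R) < k%:R by rewrite ltr0n.
have lR : (0 : R) < l%:R by rewrite ltr0n.
exists (fun j => if j \in X then c1 j else (k + c2 j)%N).
  by move=> j; case: ifP => _; [rewrite ltn_addr|rewrite ltn_add2l].
move=> i t tkl; have := HX i; set S := mass i J; set S1 := mass i X => HS.
have [tk|kt] := ltnP t k.
  have -> : [set j in J | (if j \in X then c1 j else k + c2 j)%N == t] =
      [set j in X | c1 j == t].
    apply/setP => j; rewrite !inE; case: ifPn => [/(subsetP XJ) -> //|_].
    by rewrite andFb; apply/negP => /andP[_ /eqP]; lia.
  have := Hc1 i t tk; rewrite -/S1; set v := mass i _ => Hv.
  have -> : v - (k + l)%:R^-1 * S =
      (v - k%:R^-1 * S1) + (S1 - k%:R / (k + l)%:R * S) / k%:R.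
    by rewrite natrD; field; rewrite !gt_eqF ?addr_gt0.
  apply: le_trans (ler_normD _ _) (le_trans _ He1); apply: lerD => //.
  by rewrite normrM (ger0_norm (x := _^-1)) ?invr_ge0 ?ler_wpM2r ?invr_ge0 // ltW.
have -> : [set j in J | (if j \in X then c1 j else k + c2 j)%N == t] =
    [set j in J :\: X | c2 j == (t - k)%N].
  apply/setP => j; rewrite !inE; case: ifPn => jX /=; last first.
    by congr (_ && _); lia.
  by apply/negP => /andP[_ /eqP]; have := c1k j; lia.
have := Hc2 i (t - k)%N; rewrite massD // -/S -/S1; set v := mass i _ => Hv.
have {}Hv := Hv ltac:(lia).
have -> : v - (k + l)%:R^-1 * S =
    (v - l%:R^-1 * (S - S1)) - (S1 - k%:R / (k + l)%:R * S) / l%:R.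
  by rewrite natrD; field; rewrite !gt_eqF ?addr_gt0.
apply: le_trans (ler_normB _ _) (le_trans _ He2); apply: lerD => //.
by rewrite normrM (ger0_norm (x := _^-1)) ?invr_ge0 ?ler_wpM2r ?invr_ge0 // ltW.
Qed.

Lemma colorable_of_even a h b : (0 < a)%N -> ~~ odd a -> 0 <= h -> colorable a h ->
  (0 < b)%N -> colorable b ((2 - 2 / b%:R) * (a%:R * h)).
Proof.
move=> a0 ev h0 Ha; set u := a%:R * h.
have u0 : 0 <= u by rewrite mulr_ge0 ?ler0n.
have aR : (0 : R) < a%:R by rewrite ltr0n.
have a1 : (1 < a)%N by lia.
have split p : 0 <= p <= 1 -> splittable p u.
  (* A constant [psi = a] suffices, since every digit costs at most [a - 1]. *)
  apply: (splittable_expansion (psi := fun=> a%:R) a1 h0 Ha) => // d q da _.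
  by rewrite divff ?gt_eqF // natr1 ler_nat /digit_cost; lia.
(* As [a] is even, [a./2] color classes form the fraction 1/2. *)
have half : splittable 2^-1 (u / 2).
  have aE : a = (a./2 + a./2)%N by rewrite addnn even_halfK.
  have := colorable_splittable (d := a./2) (a := a) _ Ha.
  have -> : (a./2)%:R = a%:R / 2 :> R.
    by rewrite {2}aE natrD; field.
  rewrite (_ : a%:R / 2 / a%:R = 2^-1); last by field; rewrite gt_eqF.
  by rewrite (_ : a%:R / 2 * h = u / 2); [apply; lia|rewrite /u; ring].
have [n] := ubnP b; elim: n b => // n IHn b bn b0.
have [k0|k0] := posnP b./2.
  have -> : b = 1%N by lia.
  by apply: colorable_le colorable1; rewrite divr1 subrr mul0r.
have kR : (0 : R) < (b./2)%:R by rewrite ltr0n.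
(* With [k = b./2], halving adds [(u / 2) / k] to the bound [(2 - 2 / k) * u]. *)
have dbl : colorable (b./2 + b./2) ((2 - 3 / (2 * (b./2)%:R)) * u).
  have IH := IHn b./2 ltac:(lia) k0.
  have le : (2 - 2 / (b./2)%:R) * u + u / 2 / (b./2)%:R
      <= (2 - 3 / (2 * (b./2)%:R)) * u.
    by rewrite le_eqVlt; apply/orP; left; apply/eqP; field; rewrite gt_eqF.
  apply: (colorable_add _ _ _ IH IH le le) => //.
  rewrite (_ : _ / _ = 2^-1) //.
  by rewrite natrD; field; rewrite gt_eqF ?addr_gt0.
case ob: (odd b); last first.
  have bE : b = (b./2 + b./2)%N by lia.
  rewrite -bE in dbl; apply: colorable_le dbl; apply: ler_wpM2r => //.
  rewrite lerD2l lerN2 [in leLHS]bE natrD.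
  rewrite -subr_ge0 (_ : _ - _ = (2 * (b./2)%:R)^-1).
    by rewrite invr_ge0 mulr_ge0 // ltW.
  by field; rewrite !gt_eqF ?addr_gt0.
have bE : b = (1 + (b./2 + b./2))%N.
  by rewrite addnn -[LHS]odd_double_half ob.
have bR : b%:R = 1 + 2 * (b./2)%:R :> R by rewrite [in LHS]bE !natrD; ring.
have b_gt0 : (0 : R) < 1 + 2 * (b./2)%:R by rewrite addr_gt0 ?mulr_gt0.
(* The single color bears the full error [u], allowed because [2 - 2 / b >= 1]; the other [2k]
   colors go from [2 - 3 / (2k)] to [2 - 2 / (2k)], in units of [u]. *)
rewrite bR {1}bE; apply: (colorable_add (D := u) _ _ _ colorable1 dbl) => //;
  first by lia.
- apply: split; rewrite divr_ge0 ?ler0n //= ler_pdivrMr ?ltr0n ?mul1r ?ler_nat; lia.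
- rewrite add0r divr1 -[leLHS]mul1r; apply: ler_wpM2r => //.
  have -> : 2 - 2 / (1 + 2 * (b./2)%:R) =
      1 + (2 * (b./2)%:R - 1) / (1 + 2 * (b./2)%:R) :> R.
    by field; rewrite gt_eqF.
  rewrite lerDl divr_ge0 ?(ltW b_gt0) // subr_ge0 -natrM ler1n; lia.
- rewrite (_ : _ + _ = (2 - 2 / (2 * (b./2)%:R)) * u); last first.
    by rewrite natrD; field; rewrite !gt_eqF ?addr_gt0.
  apply: ler_wpM2r => //; rewrite lerD2l lerN2 ler_wpM2l //.
  rewrite lef_pV2 ?posrE ?mulr_gt0 //.
  by rewrite lerDr.
Qed.

Lemma splittable_of_odd a h p : (1 < a)%N -> odd a -> 0 <= h -> colorable a h ->
  0 <= p <= 1 -> splittable p ((2^-1 + Num.min p (1 - p)) * (a%:R * h)).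
Proof.
move=> a1 oa h0 Ha p01; have a0 : (0 : R) < a%:R by rewrite ltr0n ltnW.
rewrite mulrA [_ * a%:R]mulrC.
apply: (splittable_expansion
  (psi := fun p => a%:R * (2^-1 + Num.min p (1 - p))) a1 h0 Ha)
  => // {p p01} [q|d q da] /andP[q0 q1].
  by rewrite mulr_ge0 ?addr_ge0 ?invr_ge0 ?ler0n // le_min q0 subr_ge0.
rewrite [a%:R * _]mulrC mulfK ?gt_eqF // mulrDr minr_pMr; last exact: ltW.
rewrite mulrBr mulr1 [a%:R * (_ / _)]mulrC divfK ?gt_eqF //.
pose g := a./2; have aE : a = (1 + 2 * g)%N by rewrite /g; lia.
rewrite aE natrD natrM.
(* At the middle digit [g] the inequality is an equality, which accounts for the shape of [psi]: all
   digits of 1/2 equal [g]. *)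
have [dg|gd|dg] := ltngtP d g.
- have -> : digit_cost (1 + 2 * g) d = (2 * d + 1)%N by rewrite /digit_cost; lia.
  have : (d%:R : R) + 1 <= g%:R by rewrite natr1 ler_nat.
  rewrite natrD natrM => ?.
  by case: (leP q (1 - q)) => ?; case: (leP (_ + q)) => ?; lra.
- have -> : digit_cost (1 + 2 * g) d = (1 + 2 * (2 * g - d))%N.
    by rewrite /digit_cost; lia.
  have : (g%:R : R) + 1 <= d%:R by rewrite natr1 ler_nat.
  rewrite natrD natrM natrB ?natrM; last by lia.
  by move=> ?; case: (leP q (1 - q)) => ?; case: (leP (_ + q)) => ?; lra.
- have -> : digit_cost (1 + 2 * g) d = (2 * g)%N by rewrite /digit_cost; lia.
  rewrite dg natrM.
  by case: (leP q (1 - q)) => ?; case: (leP (_ + q)) => ?; lra.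
Qed.

Lemma colorable_of_odd a h j b : (1 < a)%N -> odd a -> 0 <= h -> colorable a h ->
  (0 < b <= 2 ^ j)%N ->
  colorable b ((2 - b%:R^-1 - (2 ^ j)%:R^-1) * (a%:R * h)).
Proof.
move=> a1 oa h0 Ha; set u := a%:R * h.
have u0 : 0 <= u by rewrite mulr_ge0 ?ler0n.
elim: j b => [|j IHj] b /andP[b0 bj].
  have -> : b = 1%N by lia.
  by apply: colorable_le colorable1; rewrite expn0 invr1 -addrA -opprD subrr mul0r.
have M0 : (0 < 2 ^ j)%N by rewrite expn_gt0.
have MR : (0 : R) < (2 ^ j)%:R by rewrite ltr0n.
(* If [2 ^ j] already reaches [b], the previous bound is enough, as the bound grows with [j]. *)
have [bM|Mb] := leqP b (2 ^ j).
  apply: colorable_le (IHj b _); last by rewrite b0.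
  apply: ler_wpM2r => //; rewrite lerD2l lerN2 lef_pV2 ?posrE ?ltr0n ?expn_gt0 //.
  by rewrite ler_nat leq_exp2l.
pose r := (b - 2 ^ j)%N; have r0 : (0 < r)%N by rewrite subn_gt0.
have rM : (r <= 2 ^ j)%N by rewrite /r; move: bj; rewrite expnS; lia.
have bE : b = (r + 2 ^ j)%N by rewrite /r; lia.
have rR : (0 : R) < r%:R by rewrite ltr0n.
have rMR : (r%:R : R) <= (2 ^ j)%:R by rewrite ler_nat.
rewrite expnS natrM bE.
have := @splittable_of_odd a h (r%:R / (r + 2 ^ j)%:R) a1 oa h0 Ha.
rewrite natrD; move: (IHj r) (IHj (2 ^ j)%N); rewrite r0 M0 leqnn rM.
set M : R := (2 ^ j)%:R in MR rMR *; set x : R := r%:R in rR rMR *.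
move=> /(_ isT) Hr /(_ isT) HM.
have xM : 0 < x + M by rewrite addr_gt0.
have -> : Num.min (x / (x + M)) (1 - x / (x + M)) = x / (x + M).
  apply/min_idPl; rewrite (_ : 1 - _ = M / (x + M)); last by field; rewrite gt_eqF.
  by rewrite ler_wpM2r // invr_ge0 ltW.
rewrite -/u => HD.
apply: (colorable_add (D := (2^-1 + x / (x + M)) * u) _ _ _ Hr HM) => //.
- rewrite natrD; apply: HD; rewrite divr_ge0 ?(ltW rR) ?(ltW xM) //=.
  by rewrite ler_pdivrMr // mul1r lerDl ltW.
- rewrite mulrAC -mulrDl; apply: ler_wpM2r => //; rewrite -subr_ge0.
  (* The slack for the [r] colors is a multiple of a square; for the [2 ^ j] colors the bound is met
     with equality. *)
  rewrite (_ : _ - _ = (x - M) ^+ 2 / (2 * x * M * (x + M))).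
    by rewrite divr_ge0 ?sqr_ge0 // ltW // !mulr_gt0.
  by field; rewrite !gt_eqF.
- rewrite mulrAC -mulrDl; apply: ler_wpM2r => //.
  by rewrite le_eqVlt; apply/orP; left; apply/eqP; field; rewrite !gt_eqF.
Qed.

Lemma colorable_any a h b : (1 < a)%N -> 0 <= h -> colorable a h ->
  (0 < b)%N -> colorable b (2 * a%:R * h).
Proof.
move=> a1 h0 Ha b0; have u0 : 0 <= a%:R * h by rewrite mulr_ge0 ?ler0n.
rewrite -mulrA; case oa: (odd a).
  (* Any exponent [j] with [b <= 2 ^ j] would do. *)
  apply: colorable_le (colorable_of_odd (j := b) a1 oa h0 Ha _).
    by apply: ler_wpM2r => //; rewrite -addrA gerDl -opprD oppr_le0 addr_ge0 ?invr_ge0.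
  by rewrite b0 ltnW // ltn_expl.
apply: colorable_le (colorable_of_even (ltnW a1) (negbT oa) h0 Ha b0).
by apply: ler_wpM2r => //; rewrite gerDl oppr_le0 divr_ge0.
Qed.

End Splitting.

(** * Hereditary discrepancy in terms of colorings *)

Section Matrices.
Variables (R : archiRealFieldType) (m n : nat) (A : 'M[R]_(m, n)).

Lemma herdisc_ge0 a : 0 <= herdisc A a.
Proof. exact: bigmax_ge_id. Qed.

(** An optimal coloring of the submatrix with all rows and the columns [J] is carried over to
    [J]. *)
Lemma herdisc_colorable a : (0 < a)%N ->
  colorable (fun i j => A i j) a (herdisc A a).
Proof.
move=> a0 J.
pose B := mxsub (@enum_val _ (mem [set: 'I_m])) (@enum_val _ (mem J)) A.
have [p pE] := disc_attained B a0.
have ple : disc_col B p <= herdisc A a.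
  rewrite -pE; apply: le_trans (le_bigmax _ _ [set: 'I_m]).
  exact: (le_bigmax _ (fun J : {set 'I_n} =>
    disc (mxsub (@enum_val _ (mem [set: 'I_m])) (@enum_val _ (mem J)) A) a) J).
(* [enum_rank_in] needs an element of [J], so the empty set is treated apart. *)
have [J0|[j0 Jj0]] := set_0Vmem J.
  exists (fun=> 0%N) => // i k _; rewrite J0.
  rewrite (_ : [set j in _ | _] = set0); last by apply/setP => j; rewrite !inE.
  by rewrite /mass !big_set0 mulr0 subr0 normr0 herdisc_ge0.
(* Outside [J] the rank is a default value, but such columns enter no color class of [J]. *)
exists (fun j => p (enum_rank_in Jj0 j)) => // i k ka.
apply: le_trans ple.
pose i' := enum_rank_in (in_setT i) i.
apply: le_trans (le_bigmax _ _ (Ordinal ka)); apply: le_trans (le_bigmax _ _ i').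
rewrite le_eqVlt; apply/orP; left; apply/eqP; congr (`| _ - _ * _ |); rewrite /mass.
  rewrite (big_enum_rank_cond Jj0 (fun s => p s == Ordinal ka)) /=.
  apply: eq_big => [j|j]; rewrite !inE // => /andP[jJ _].
  by rewrite mxE !enum_rankK_in ?inE.
rewrite (big_enum_rank Jj0) /=; apply: eq_bigr => j jJ.
by rewrite mxE !enum_rankK_in ?inE.
Qed.

(** A coloring of [J] that is good in all rows is good for every set [I] of kept rows; [0 <= e]
    covers the default value of the maxima. *)
Lemma herdisc_le b e : 0 <= e -> colorable (fun i j => A i j) b e ->
  herdisc A b <= e.
Proof.
move=> e0 Hb; apply: bigmax_le => // I _; apply: bigmax_le => // J _.
have [c cb Hc] := Hb J.
pose p := [ffun j : 'I_#|J| => Ordinal (cb (enum_val j))].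
apply: le_trans (disc_le_col _ p) _.
apply: bigmax_le => // d _; apply: bigmax_le => // i _.
apply: le_trans (Hc (enum_val i) d (ltn_ord d)).
rewrite le_eqVlt; apply/orP; left; apply/eqP; congr (`| _ - _ * _ |); rewrite /mass.
  rewrite (eq_bigl (fun j => (j \in J) && (c j == d))); last by move=> j; rewrite inE.
  rewrite big_enum_val_cond /=; apply: eq_big => [j|j _]; last by rewrite mxE.
  by rewrite ffunE.
by rewrite [RHS]big_enum_val; apply: eq_bigr => j _; rewrite mxE.
Qed.

End Matrices.

(* 2 + 5 / 10 ^+ 4 is 2.0005 *)
Theorem theorem7 (R : realType) :
  exists K : R, K <= 2 + 5 / 10 ^+ 4 /\
    forall (m n : nat) (A : 'M[R]_(m, n)) (a b : nat),
      (2 <= a)%N -> (2 <= b)%N -> herdisc A b <= K * a%:R * herdisc A a.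
Proof.
exists 2; split=> [|m n A a b a2 b2].
  by rewrite lerDl divr_ge0 ?exprn_ge0.
apply: herdisc_le; first by rewrite !mulr_ge0 ?ler0n ?herdisc_ge0.
apply: colorable_any => //; [exact: herdisc_ge0| |exact: ltnW].
exact/herdisc_colorable/ltnW.
Qed.
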